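(* Let $n\geq 3$ be a positive integer. Then $$t(n,3,4)\leq \binom{n}{2}-n+1.$$
   Context: All graphs are finite, undirected and simple. Let $G$ be a nontrivial connected graph of order $n$ (i.e. with $n$ vertices). An edge-coloring of $G$ is any assignment of colors to the edges (adjacent edges may receive the same color). A tree $T$ that is a subgraph of $G$ is a rainbow tree if no two edges of $T$ have the same color. For $S\subseteq V(G)$ with $|S|\geq 2$, a rainbow $S$-tree is a rainbow tree $T$ in $G$ with $S\subseteq V(T)$. For a fixed integer $k$ with $2\leq k\leq n$, an edge-coloring of $G$ is a $k$-rainbow coloring if for every $k$-subset $S$ of $V(G)$ there exists a rainbow $S$-tree. The $k$-rainbow index $rx_k(G)$ is the minimum number of colors needed in a $k$-rainbow coloring of $G$. The quantity $t(n,k,\ell)$ denotes the minimum size (number of edges) of a connected graph $G$ of order $n$ with $rx_k(G)\leq \ell$, where $2\leq \ell\leq n-1$ and $2\leq k\leq n$.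
   Formalization: The statement is proved for n ≥ 4 instead of n ≥ 3: at n = 3 the bound equals 1, but a connected graph of order 3 has at least 2 edges (and t(3,3,4) lies outside the range ℓ ≤ n−1 where t is defined). *)

(* Defs.v *)
From mathcomp Require Import all_boot.
Set Implicit Arguments.
Unset Strict Implicit.
Unset Printing Implicit Defensive.

(* Edges are unordered pairs of distinct vertices, so graphs are undirected and
   simple by construction. *)
Record sgraph (V : finType) := SGraph {
  edges : {set {set V}};
  edgesP : forall e : {set V}, e \in edges -> #|e| = 2 }.

Section Graphs.
Variable V : finType.
Implicit Types (G : sgraph V) (W S : {set V}) (F : {set {set V}}).

Definition adj F : rel V := fun x y => [set x; y] \in F.

Definition connected G : Prop := forall x y : V, connect (adj (edges G)) x y.

Definition subgraph G W F : Prop :=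
  F \subset edges G /\ (forall e : {set V}, e \in F -> e \subset W).

Definition acyclic F : Prop :=
  forall c : seq V, cycle (adj F) c -> uniq c -> size c < 3.

(* For (W, F) a subgraph of a graph: every F-path from a vertex of W stays in
   W, so connectivity may be tested with paths in the ambient type. *)
Definition is_tree W F : Prop :=
  [/\ W != set0, {in W &, forall x y, connect (adj F) x y} & acyclic F].

(* A coloring is given on all of {set V}; its values off the edge set of the
   graph are never looked at. *)
Definition rainbow_tree (C : Type) G (c : {set V} -> C) W F : Prop :=
  [/\ subgraph G W F, is_tree W F & {in F &, injective c}].

Definition rainbow_coloring (C : Type) k G (c : {set V} -> C) : Prop :=
  forall S, #|S| = k -> exists W F, rainbow_tree G c W F /\ S \subset W.

End Graphs.

Definition is_minimum (P : nat -> Prop) (m : nat) : Prop :=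
  P m /\ (forall p : nat, P p -> m <= p).

(* [is_rx k G r] reads rx_k(G) = r. The coloring need not use all r colors,
   which does not affect the minimum. *)
Definition is_rx (V : finType) (k : nat) (G : sgraph V) : nat -> Prop :=
  is_minimum (fun r => exists c : {set V} -> 'I_r, rainbow_coloring k G c).

Definition rx_le (V : finType) (k : nat) (G : sgraph V) (l : nat) : Prop :=
  exists2 r, is_rx k G r & r <= l.

(* [is_t n k l m] reads t(n, k, l) = m. This is a relation because, for some
   parameters (e.g. n = k = 4, l = 2), no graph qualifies and t is undefined. *)
Definition is_t (n k l : nat) : nat -> Prop :=
  is_minimum (fun m => exists (V : finType) (G : sgraph V),
    [/\ #|V| = n, connected G, rx_le k G l & #|edges G| = m]).

(* Main.v *)
Require Import Defs.
From mathcomp Require Import all_boot.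
From Stdlib Require Import Classical.

Set Implicit Arguments.
Unset Strict Implicit.
Unset Printing Implicit Defensive.

(** Attach a pendant vertex [p] to a vertex [w] of a complete graph on [n - 1]
    vertices and delete one edge [wq]: this graph has [C(n,2) - (n - 1)] edges.
    Fix a further vertex [w'] and color an edge [e] by the pair of truth values
    of [w \in e] and [w' \in e]. Every path [x - w - w' - y - z] is then
    rainbow, and each triple of vertices lies on such a path: at most three of
    its vertices avoid [w] and [w'], and they can be named [x], [y], [z] with
    [x <> q], [y <> p] and [z <> p], which makes the path available; [z] is
    omitted when two names suffice. *)

(** Well-ordering of [nat] for an arbitrary predicate, hence the classical case split. It reduces
    both minima, the rainbow index and [t], to exhibiting one witness each. *)
Lemma exists_minimum (P : nat -> Prop) (m : nat) :
  P m -> exists2 r, is_minimum P r & r <= m.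
Proof.
elim/ltn_ind: m => m IHm Pm.
case: (classic (exists2 k, P k & k < m)) => [[k Pk lt_km]|noP].
  have [r minr le_rk] := IHm k lt_km Pk; exists r => //.
  exact: leq_trans (ltnW lt_km).
exists m => //; split=> // k Pk; rewrite leqNgt; apply/negP => lt_km.
by apply: noP; exists k.
Qed.

(** * Growing rainbow trees leaf by leaf *)

Lemma adj_sym (V : finType) (F : {set {set V}}) : symmetric (adj F).
Proof. by move=> x y; rewrite /adj setUC. Qed.

Lemma connect_adjS (V : finType) (F F' : {set {set V}}) :
  F \subset F' -> subrel (connect (adj F)) (connect (adj F')).
Proof.
move=> sFF'; apply: connect_sub => x y xyF.
by apply: connect1; apply: (subsetP sFF').
Qed.

(** A cycle avoiding [v] already lies in [F]. A cycle through [v], rotated to start there, has [u]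
    as both its second and its last vertex, since [v] has no other neighbor; from length 3 on these
    are distinct entries. *)
Lemma acyclic_leaf (V : finType) (F : {set {set V}}) (u v : V) :
  (forall e, e \in F -> v \notin e) -> acyclic F -> acyclic ([set u; v] |: F).
Proof.
move=> vF acF c cycc uniqc.
have adjv a : a != v -> adj ([set u; v] |: F) v a -> a = u.
  move=> av; rewrite /adj in_setU1 => /orP[/eqP E|/vF]; last by rewrite set21.
  by have := set22 v a; rewrite E in_set2 (negPf av) orbF => /eqP.
have adjF a b : a != v -> b != v -> adj ([set u; v] |: F) a b -> adj F a b.
  move=> av bv; rewrite /adj in_setU1 => /orP[/eqP E|//].
  by have := set22 u v; rewrite -E in_set2 ![v == _]eq_sym (negPf av) (negPf bv).
have [vc|vc] := boolP (v \in c); last first.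
  apply: acF => //; apply: (sub_in_cycle _ (allss c) cycc).
  by move=> a b ac bc; apply: adjF; [move: ac | move: bc]; apply: contraTneq => ->.
have [i c' def_c] := rot_to vc.
rewrite -(size_rot i) def_c.
move: cycc uniqc; rewrite -(rot_cycle i) -(rot_uniq i) def_c.
case: c' {def_c} => [//|a [//|b c']].
rewrite /= rcons_path => /and3P[va _ /andP[_ lastv]].
rewrite !inE !negb_or -!andbA => /and5P[av bv vc' ab /andP[ac' _]].
have ea : a = u by apply: adjv; rewrite // eq_sym.
have lbc : last b c' \in b :: c' by apply: mem_last.
have el : last b c' = u.
  apply: adjv; last by rewrite adj_sym.
  by apply: contraTneq lbc => ->; rewrite inE negb_or bv.
by move: lbc; rewrite el -ea inE (negPf ab) (negPf ac').
Qed.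

Section RainbowTrees.
Variables (V : finType) (C : Type) (G : sgraph V) (c : {set V} -> C).

Lemma rainbow_tree1 (x : V) : rainbow_tree G c [set x] set0.
Proof.
split.
- by split=> [|e]; rewrite ?sub0set ?inE.
- split; first by apply/set0Pn; exists x; rewrite set11.
    by move=> a b /set1P-> /set1P->.
  by case=> [|a [|b s]] //=; rewrite {1}/adj inE.
- by move=> e; rewrite inE.
Qed.

(** With this growth step the explicit paths below never need a direct check of acyclicity or
    connectedness. *)
Lemma rainbow_tree_leaf (W : {set V}) (F : {set {set V}}) (u v : V) :
  rainbow_tree G c W F -> u \in W -> v \notin W -> [set u; v] \in edges G ->
  (forall e, e \in F -> c e <> c [set u; v]) ->
  rainbow_tree G c (v |: W) ([set u; v] |: F).
Proof.
move=> [[sFG sFW] [W0 conW acF] injc] uW vW uvG cuv.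
have uv1 : connect (adj ([set u; v] |: F)) v u.
  by rewrite connect1 // adj_sym /adj setU11.
have symF' := sym_connect_sym (@adj_sym _ ([set u; v] |: F)).
have conu a : a \in v |: W -> connect (adj ([set u; v] |: F)) a u.
  case/setU1P=> [->//|aW]; apply: connect_adjS (conW _ _ aW uW).
  exact: subsetUr.
split.
- split; first by rewrite subUset sub1set uvG.
  move=> e /setU1P[->|/sFW sew].
    by rewrite subUset !sub1set setU11 !inE uW orbT.
  exact: subset_trans sew (subsetUr _ _).
- split; first by apply/set0Pn; exists v; rewrite setU11.
    move=> a b /conu au /conu bu; apply: connect_trans au _.
    by rewrite symF'.
  apply: acyclic_leaf => // e /sFW sew; apply: contra vW; exact: (subsetP sew).
- move=> e f /setU1P[->|eF] /setU1P[->|fF] //; last exact: injc.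
  + by move/esym/(cuv _ fF).
  + by move/(cuv _ eF).
Qed.

End RainbowTrees.

(** Used to name [y] (preferring [q]) and [x] (preferring [p]) from a triple. The default [a] for
    empty [A] still yields a usable path vertex when the triple supplies none. *)
Lemma preferred_element (V : finType) (A : {set V}) (a : V) :
  exists y, [/\ a \in A -> y = a, A != set0 -> y \in A & y \in A \/ y = a].
Proof.
have [aA|aA] := boolP (a \in A); first by exists a; split=> //; right.
have [->|[y yA]] := set_0Vmem A; last by exists y; split=> //; left.
by exists a; split; rewrite ?eqxx //; right.
Qed.

(** * The graph: size, rainbow paths, connectedness *)

Section Construction.
Variables (V : finType) (w w' p q : V).
Hypothesis uniq_wpq : uniq [:: w; w'; p; q].

Definition pendant_edges : {set {set V}} :=
  [set e : {set V} | [&& #|e| == 2, (p \in e) ==> (w \in e)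
                       & ~~ ((w \in e) && (q \in e))]].

Lemma pendant_edgesP (e : {set V}) : e \in pendant_edges -> #|e| = 2.
Proof. by rewrite inE => /and3P[/eqP]. Qed.

Definition pendant_graph := SGraph pendant_edgesP.

Definition pendant_color (e : {set V}) : 'I_4 :=
  inord ((w \in e).*2 + (w' \in e)).

Lemma pendant_color_inj (e f : {set V}) : pendant_color e = pendant_color f ->
  (w \in e) = (w \in f) /\ (w' \in e) = (w' \in f).
Proof.
move/(congr1 val); rewrite /= !inordK.
- by do 4!case: (_ \in _).
- by do 2!case: (_ \in _).
- by do 2!case: (_ \in _).
Qed.

(** The map [f] injects the vertices other than [p] into the missing pairs: [w] goes to the deleted
    edge [wq], any other [x] to the non-edge [px]. *)
Lemma card_pendant_edges : #|pendant_edges| <= 'C(#|V|, 2) - #|V| + 1.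
Proof.
move: uniq_wpq; rewrite /= !inE !negb_or -!andbA.
move=> /and5P[ww' wp wq w'p /and3P[w'q pq _]].
pose f x := if x == w then [set w; q] else [set p; x].
pose D := [set e : {set V} | #|e| == 2].
have injf : {in [set~ p] &, injective f}.
  move=> x y; rewrite !inE /f => xp yp.
  have np : p \in [set w; q] = false.
    by rewrite !inE ![p == _]eq_sym (negPf wp) eq_sym (negPf pq).
  case: eqP => [->|_]; case: eqP => [->|_] // E.
  + by have := np; rewrite E set21.
  + by have := np; rewrite -E set21.
  + by have := set22 p x; rewrite E !inE (negPf xp) => /eqP.
have fD : f @: [set~ p] \subset D :\: pendant_edges.
  apply/subsetP => _ /imsetP[x xp ->]; move: xp; rewrite !inE /f => xp.
  have [_|xw] := eqVneq x w; first by rewrite cards2 wq !inE !eqxx orbT /= andbF.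
  by rewrite cards2 [p == x]eq_sym xp !inE eqxx [w == x]eq_sym (negPf xw) (negPf wp).
have sED : pendant_edges \subset D.
  by apply/subsetP => e /pendant_edgesP; rewrite inE => ->.
have := subset_leq_card fD; rewrite (card_in_imset injf) cardsC1 cardsDS //.
rewrite (card_draws V 2) => le_n.
have le_E : #|pendant_edges| <= 'C(#|V|, 2).
  by rewrite -(card_draws V 2); apply: subset_leq_card.
move: le_n le_E; have : 0 < #|V| by apply/card_gt0P; exists w.
case: #|V| => [//|n] _ /=.
set b := 'C(_, _); set m := #|_| => le_n le_E.
(* Now [n] is one less than the order, and the bound reads [(b - n).-1.+1], which is at least
   [b - n] even if the subtraction truncates. *)
rewrite addn1 subnS; apply: leq_trans (leqSpred _).
have le_mn : m + n <= b by rewrite -leq_subRL.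
by rewrite leq_subRL ?(leq_trans (leq_addl m n)) // addnC.
Qed.

(** The truth values on [xw], [ww'], [w'y] are 10, 11, 01. The edge [xw] survives because [x != q],
    and [w'y] because [y != p]. *)
Lemma rainbow_path4 (x y : V) : uniq [:: w; w'; x; y] -> x != q -> y != p ->
  rainbow_tree pendant_graph pendant_color (y |: (w' |: (x |: [set w])))
    ([set w'; y] |: ([set w; w'] |: ([set w; x] |: set0))).
Proof.
move: uniq_wpq; rewrite /= !inE !negb_or -!andbA.
move=> /and5P[ww' wp wq w'p /and3P[w'q pq _]].
move=> /and5P[_ wx wy w'x /and3P[w'y xy _]] xq yp.
have sy (a b : V) : a != b -> ((a == b) = false) * ((b == a) = false).
  by move=> /negPf ab; rewrite [b == a]eq_sym ab.
(* A single multirule, with each disequality in both orientations, settles the edge and color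
   conditions. *)
pose neq := (sy _ _ ww', sy _ _ wp, sy _ _ wq, sy _ _ w'p, sy _ _ w'q,
  sy _ _ wx, sy _ _ wy, sy _ _ w'x, sy _ _ w'y, sy _ _ xy, sy _ _ xq, sy _ _ yp,
  eqxx, implybT).
do 3?apply: rainbow_tree_leaf; first exact: rainbow_tree1.
all: rewrite ?inE ?cards2 ?neq //= => e; rewrite ?inE ?orbF //.
- by move/eqP-> => /pendant_color_inj; rewrite !inE ?neq => -[].
- by case/pred2P=> -> /pendant_color_inj; rewrite !inE ?neq => -[].
Qed.

(** The new edge [yz] avoids both [w] and [w'], so it takes the one color left, 00. *)
Lemma rainbow_path5 (x y z : V) : uniq [:: z; w; w'; x; y] ->
  x != q -> y != p -> z != p ->
  rainbow_tree pendant_graph pendant_color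
    (z |: (y |: (w' |: (x |: [set w]))))
    ([set y; z] |: ([set w'; y] |: ([set w; w'] |: ([set w; x] |: set0)))).
Proof.
rewrite cons_uniq => /andP[zn Uxy] xq yp zp; apply: rainbow_tree_leaf.
- exact: rainbow_path4.
- by rewrite !inE eqxx.
- by apply: contra zn; rewrite !inE => /or4P[]->; rewrite ?orbT.
- move: zn Uxy; rewrite /= !inE !negb_or => /and4P[zw zw' zx zy].
  move=> /and4P[/and3P[ww' wx wy] _ _ _].
  by rewrite cards2 ![_ == z]eq_sym zy ![p == _]eq_sym (negPf yp) [z == p](negPf zp)
    (negPf wy) (negPf zw).
- have [nw nw'] : (w \in [set y; z]) = false /\ (w' \in [set y; z]) = false.
    move: zn Uxy; rewrite /= !inE !negb_or => /and4P[zw zw' zx zy].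
    move=> /and4P[/and3P[_ _ wy] /andP[_ w'y] _ _].
    by rewrite [w == z]eq_sym [w' == z]eq_sym (negPf wy) (negPf w'y)
      (negPf zw) (negPf zw').
  move=> e; rewrite !inE orbF => /or3P[]/eqP-> /pendant_color_inj; rewrite nw nw';
    by rewrite !inE eqxx ?orbT => -[].
Qed.

Lemma pendant_rainbow_coloring : rainbow_coloring 3 pendant_graph pendant_color.
Proof.
move=> S S3; move: uniq_wpq; rewrite /= !inE !negb_or -!andbA.
move=> /and5P[ww' wp wq w'p /and3P[w'q pq _]].
have [y [yq yA y_or]] := preferred_element (S :\: [set w; w'; p]) q.
have [x [xp xB x_or]] := preferred_element (S :\: [set w; w'; y]) p.
have [yw yw' yp] : [/\ w != y, w' != y & y != p].
  case: y_or => [|-> //]; last by rewrite [q == p]eq_sym.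
  by rewrite !inE !negb_or ![y == _]eq_sym -!andbA => /and4P[].
have [xw xw' xy] : [/\ w != x, w' != x & x != y].
  case: x_or => [|-> ]; last by rewrite [p == y]eq_sym.
  by rewrite !inE !negb_or => /andP[/andP[/andP[]]]; rewrite ![x == _]eq_sym.
(* If [x] were [q], then [q] would lie in [S] and the preference would have given [y = q], against
   [x != y]. *)
have xq : x != q.
  apply/eqP => exq; move: xy; rewrite exq yq ?eqxx //.
  case: x_or => [|xp']; last by move: pq; rewrite -exq xp' eqxx.
  by rewrite exq !inE !negb_or -!andbA => /and4P[-> -> _ ->]; rewrite eq_sym pq.
have Uxy : uniq [:: w; w'; x; y].
  by rewrite /= !inE !negb_or ww' xw yw xw' yw' xy.
(* A vertex [z] of [S] off the short path lies in both candidate sets, so [x] and [y] come from [S]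
   and [S] is exactly [x], [y], [z]. *)
have [sSW|/subsetPn[z zS zn]] := boolP (S \subset y |: (w' |: (x |: [set w]))).
  by do 2!eexists; split; first exact: rainbow_path4 Uxy xq yp.
move: zn; rewrite !inE !negb_or => /and4P[zy zw' zx zw].
have zB : z \in S :\: [set w; w'; y] by rewrite !inE zS !negb_or zw zw' zy.
have xS : x \in S :\: [set w; w'; y] by apply: xB; apply/set0Pn; exists z.
(* Had [p] been available, it would have been chosen as [x]. *)
have zp : z != p by apply: contra zx => /eqP ezp; rewrite ezp xp // -ezp.
have zA : z \in S :\: [set w; w'; p] by rewrite !inE zS !negb_or zw zw' zp.
have yS : y \in S :\: [set w; w'; p] by apply: yA; apply/set0Pn; exists z.
have Uxyz : uniq [:: z; w; w'; x; y].
  by rewrite cons_uniq Uxy !inE !negb_or zy zx zw zw'.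
do 2!eexists; split; first exact: rainbow_path5 Uxyz xq yp zp.
have /eqP <- : [set x; y; z] == S.
  rewrite eqEcard S3 -setUA cardsU1 cards2 !inE !negb_or xy.
  rewrite [x == z]eq_sym zx [y == z]eq_sym zy !subUset !sub1set zS.
  by move: xS yS; rewrite !inE => /andP[_ ->] /andP[_ ->].
by apply/subsetP => a; rewrite !inE -orbA => /or3P[] ->; rewrite ?orbT.
Qed.

(** The hub is [w'], adjacent to every other vertex except [p], which is reached through [w]. *)
Lemma pendant_connected : connected pendant_graph.
Proof.
move: uniq_wpq; rewrite /= !inE !negb_or -!andbA.
move=> /and5P[ww' wp wq w'p /and3P[w'q pq _]].
have symE := sym_connect_sym (@adj_sym _ pendant_edges).
have ew : adj pendant_edges w' w.
  rewrite /adj inE cards2 !inE !eqxx !orbT implybT negb_or.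
  by rewrite [w' == w]eq_sym [q == w']eq_sym [q == w]eq_sym ww' w'q wq.
suff con a : connect (adj pendant_edges) w' a.
  by move=> a b; apply: connect_trans (con b); rewrite symE.
have [->|aw'] := eqVneq a w'; first exact: connect0.
have [->|aw] := eqVneq a w; first exact: connect1.
have [->|ap] := eqVneq a p.
  apply: connect_trans (connect1 ew) (connect1 _).
  rewrite /adj inE cards2 wp !inE !eqxx implybT negb_or.
  by rewrite [q == w]eq_sym [q == p]eq_sym wq pq.
apply: connect1; rewrite /adj inE cards2 !inE [w' == a]eq_sym aw'.
by rewrite [p == w']eq_sym (negPf w'p) [p == a]eq_sym (negPf ap)
  (negPf ww') [w == a]eq_sym (negPf aw).
Qed.

End Construction.

Theorem theorem2p7 (n : nat) (hn : 4 <= n) :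
  exists2 m : nat, is_t n 3 4 m & m <= 'C(n, 2) - n + 1.
Proof.
(* The vertices 0, 1, 2, 3 play [w], [w'], [p], [q]; vertex 1 enters only through the coloring. *)
pose v (k : nat) (lt_k4 : k < 4) : 'I_n := Ordinal (leq_trans lt_k4 hn).
have Uv : uniq [:: @v 0 isT; @v 1 isT; @v 2 isT; @v 3 isT] by [].
pose G := pendant_graph (@v 0 isT) (@v 2 isT) (@v 3 isT).
have rxG : rx_le 3 G 4.
  apply: exists_minimum; exists (pendant_color (@v 0 isT) (@v 1 isT)).
  exact: pendant_rainbow_coloring Uv.
have [|m tm le_m] := @exists_minimum (fun m => exists (V : finType) (G : sgraph V),
    [/\ #|V| = n, connected G, rx_le 3 G 4 & #|edges G| = m]) #|edges G|.
  by exists 'I_n, G; split=> //; [exact: card_ord | exact: pendant_connected Uv].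
exists m => //; apply: leq_trans le_m _.
by have := card_pendant_edges Uv; rewrite card_ord.
Qed.
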